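(* No order-unaware algorithm has order-competitive ratio strictly better than $\frac{11}{12}$ on the class $\mathcal C$ of (asymptotic) instances satisfying assumptions (1)–(5) of the context. That is, for every (possibly randomized) order-unaware algorithm and every $c>\frac{11}{12}$ there is an asymptotic instance $(I_k)_{k\ge1}\in\mathcal C$ with $\liminf_{k\to\infty} \mathrm{ALG}(I_k)/\mathrm{OPT_{online}}(I_k)<c$.
   Context: Problem. An instance $I$ consists of a finite edge-weighted bipartite graph $(U\cup V,E,w)$ with weights $w_{it}\ge0$, probabilities $p\in[0,1]^V$, and an arrival order of $V$. Online vertices $t\in V$ arrive in this order; upon arrival the identity of $t$ and whether it is realized are observed ($t$ is realized independently with probability $p_t$). If realized, $t$ may be immediately and irrevocably matched to a currently unmatched neighbour $i\in U$, collecting $w_{it}$; each vertex is matched at most once. An order-unaware algorithm knows $U,V,E,w,p$ in advance but not the arrival order; $\mathrm{ALG}(I)$ is its expected reward. $\mathrm{OPT_{online}}(I)$ is the maximum expected reward of an online algorithm that also knows the arrival order. $\mathrm{LP_{ex\text{-}ante}}(I)=\max\{\sum_{(i,t)\in E} w_{it}x_{it}: x\ge0,\ \sum_i x_{it}\le p_t\ \forall t\in V,\ \sum_t x_{it}\le 1\ \forall i\in U\}$. The class $\mathcal C$. An asymptotic instance is a sequence $(I_k)_{k\ge1}$ of instances with the same graph $(U\cup V,E)$ and arrival order, a fixed partition of $V$ into deterministic vertices $D$ and free vertices $F$, and fixed values $v_t\geq 0$ ($t\in V$), such that: (1) in every $I_k$, $p_t=1$ for $t\in D$, and $p_t=p_t^{(k)}\in(0,1]$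 with $p_t^{(k)}\to0$ as $k\to\infty$ for $t\in F$; (2) weights are online-vertex weights: $w_{it}=w_t$ for every $(i,t)\in E$, with $w_t p_t=v_t$ in every $I_k$, and every online vertex has at least one neighbour; (3) $\lim_{k}\mathrm{OPT_{online}}(I_k)=\lim_k \mathrm{LP_{ex\text{-}ante}}(I_k)$; (4) (Balancedness) letting $M^*$ be a maximum-weight matching between $U$ and $D$, and $w_i$ the weight of the edge of $M^*$ at $i\in U$ ($w_i=0$ if $i$ is unmatched), one has $w_i=v_i$ for every $i\in U$, where $v_i=\sum_{t\in F:\,(i,t)\in E}v_t$; (5) (Uniqueness) every free vertex has exactly one neighbour. *)

(* Defs.v *)
From HB Require Import structures.
From mathcomp Require Import all_boot all_order all_algebra.
From mathcomp Require Import all_classical all_reals all_analysis.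
Import Order.TTheory GRing.Theory Num.Theory.
Import numFieldNormedType.Exports.

Set Implicit Arguments.
Unset Strict Implicit.
Unset Printing Implicit Defensive.

Local Open Scope classical_set_scope.
Local Open Scope ring_scope.

(* The part of an instance on the graph (U, V, E) that is known in advance:
   everything except the arrival order. Weights live on edges only; off the
   edges they are fixed to 0 so that they carry no extra information. *)
Record network (R : realType) (U V : finType) (E : U -> V -> bool) := Network {
  weight : U -> V -> R;
  prob : V -> R;
  weight_ge0 : forall i t, 0 <= weight i t;
  weight_off : forall i t, ~~ E i t -> weight i t = 0;
  prob_ge0 : forall t, 0 <= prob t;
  prob_le1 : forall t, prob t <= 1
}.

Definition arrival_order (V : finType) (s : seq V) : Prop :=
  perm_eq s (enum V).

(* What has been observed and done so far, oldest event first: the vertex that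
   arrived, whether it was realized, and the offline vertex it was matched to. *)
Definition history (U V : finType) := seq (V * bool * option U).

Definition matched (U V : finType) (h : history U V) : seq U :=
  pmap (fun e => e.2) h.

(* [decision_prob pi h t d] is the probability, given the past [h] and the arrival of
   a realized [t], of taking decision [d]: match [t] to [i] ([Some i]) or leave
   it unmatched ([None]). Decisions may depend on the earlier random choices,
   which are part of [h]. *)
Record policy (R : realType) (U V : finType) (E : U -> V -> bool) := Policy {
  decision_prob : history U V -> V -> option U -> R;
  decision_prob_ge0 : forall h t d, 0 <= decision_prob h t d;
  decision_prob_sum1 : forall h t, \sum_(d : option U) decision_prob h t d = 1;
  decision_prob_feasible : forall h t i,
    decision_prob h t (Some i) != 0 -> E i t /\ i \notin matched h
}.

Section Run.
Variables (R : realType) (U V : finType) (E : U -> V -> bool).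
Variables (N : network R E) (pi : policy R E).

(* Expectation of [f] over the complete history, when [h] has already happened
   and the vertices of [s] are still to arrive, in this order. *)
Fixpoint expect (f : history U V -> R) (h : history U V) (s : seq V) : R :=
  if s is t :: s' then
    (1 - prob N t) * expect f (rcons h (t, false, None)) s'
    + prob N t * \sum_(d : option U)
        decision_prob pi h t d * expect f (rcons h (t, true, d)) s'
  else f h.

Definition collected (h : history U V) : R :=
  \sum_(e <- h) (if e.2 is Some i then weight N i e.1.1 else 0).

Definition reward (s : seq V) : R := expect collected [::] s.

End Run.

(* An order-unaware algorithm chooses its policy without access to the order. *)
Definition order_unaware (R : realType) : Type :=
  forall (U V : finType) (E : U -> V -> bool), network R E -> policy R E.

Definition ALG (R : realType) (A : order_unaware R) (U V : finType)
    (E : U -> V -> bool) (N : network R E) (s : seq V) : R :=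
  reward N (A U V E N) s.

(* Here the policy is optimized for the given order [s]. *)
Definition OPT_online (R : realType) (U V : finType) (E : U -> V -> bool)
    (N : network R E) (s : seq V) : R :=
  sup (range (fun pi : policy R E => reward N pi s)).

Section ExAnteLP.
Variables (R : realType) (U V : finType) (E : U -> V -> bool).
Variable N : network R E.

Definition ex_ante_feasible (x : U -> V -> R) : Prop :=
  [/\ forall i t, E i t -> 0 <= x i t,
      forall t, \sum_(i | E i t) x i t <= prob N t &
      forall i, \sum_(t | E i t) x i t <= 1].

Definition ex_ante_value (x : U -> V -> R) : R :=
  \sum_i \sum_(t | E i t) weight N i t * x i t.

Definition LP_ex_ante : R := sup (ex_ante_value @` ex_ante_feasible).

End ExAnteLP.

Section Matching.
Variables (R : realType) (U V : finType) (E : U -> V -> bool).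
Variables (N : network R E) (D : {set V}).

Definition matching_to (M : {set U * V}) : Prop :=
  (forall e, e \in M -> E e.1 e.2 /\ e.2 \in D) /\
  (forall e e', e \in M -> e' \in M -> e.1 = e'.1 \/ e.2 = e'.2 -> e = e').

Definition matching_weight (M : {set U * V}) : R :=
  \sum_(e in M) weight N e.1 e.2.

Definition max_weight_matching_to (M : {set U * V}) : Prop :=
  matching_to M /\
  forall M', matching_to M' -> matching_weight M' <= matching_weight M.

(* At most one term when [M] is a matching, and 0 when [i] is unmatched. *)
Definition weight_at (M : {set U * V}) (i : U) : R :=
  \sum_(t | (i, t) \in M) weight N i t.

End Matching.

(* The free vertices are the complement of the deterministic ones. *)
Record asym_instance (R : realType) := AsymInstance {
  offline : finType;
  online : finType;
  edge : offline -> online -> bool;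
  arrivals : seq online;
  arrivalsP : arrival_order arrivals;
  determ : {set online};
  val_of : online -> R;
  val_of_ge0 : forall t, 0 <= val_of t;
  net : nat -> network R edge
}.

Section ClassC.
Variables (R : realType) (I : asym_instance R).

Definition OPT_seq (k : nat) : R := OPT_online (net I k) (arrivals I).

Definition LP_seq (k : nat) : R := LP_ex_ante (net I k).

Definition ALG_seq (A : order_unaware R) (k : nat) : R :=
  ALG A (net I k) (arrivals I).

Definition asymptotic_probs : Prop :=
  (forall k t, t \in determ I -> prob (net I k) t = 1) /\
  (forall t, t \notin determ I ->
     (forall k, 0 < prob (net I k) t) /\
     prob (net I k) t @[k --> \oo] --> (0 : R)).

Definition online_vertex_weights : Prop :=
  (forall k, exists w : online I -> R,
     (forall i t, edge i t -> weight (net I k) i t = w t) /\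
     (forall t, w t * prob (net I k) t = val_of t)) /\
  (forall t : online I, exists i, edge i t).

Definition online_matches_LP : Prop :=
  exists l : R, OPT_seq k @[k --> \oo] --> l /\ LP_seq k @[k --> \oo] --> l.

Definition free_val (i : offline I) : R :=
  \sum_(t | (t \notin determ I) && edge i t) val_of t.

Definition balanced : Prop :=
  forall k (M : {set offline I * online I}),
    max_weight_matching_to (net I k) (determ I) M ->
    forall i, weight_at (net I k) M i = free_val i.

Definition unique_neighbour : Prop :=
  forall t, t \notin determ I -> #|[pred i : offline I | edge i t]| = 1%N.

Definition class_C : Prop :=
  [/\ asymptotic_probs, online_vertex_weights, online_matches_LP,
      balanced & unique_neighbour].

End ClassC.

(* Main.v *)
Require Import Defs.
From mathcomp Require Import all_boot all_order all_algebra.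
From mathcomp Require Import all_classical all_reals all_analysis.
From mathcomp Require Import ring lra.
Import Order.TTheory GRing.Theory Num.Theory.
Import numFieldNormedType.Exports.

Set Implicit Arguments.
Unset Strict Implicit.
Unset Printing Implicit Defensive.

Local Open Scope classical_set_scope.
Local Open Scope ring_scope.

(** The hard instance has offline vertices 0, 1, 2, each with one free vertex of
    value 1, and deterministic vertices 0, 1, 2 of weight 1, where [j] is adjacent
    to every [i <> j].  For [e = 1, -1] consider the arrival order

      free 1, free -1, det 0, det e, free 0, det -e   (indices mod 3).

    Matching det [j] to [j + e] uses every offline vertex after its free vertex, so
    the online optimum and the LP both tend to 6.  When det 0 arrives the two orders
    are still indistinguishable; if it is not matched to [e], the algorithm gets at
    most 3 instead of 4 from there on.  Hence the two expected rewards of any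
    order-unaware algorithm sum to at most 11, against 12 for the optimum, and
    one of the two orders keeps the ratio at most 11/12 + o(1) infinitely often. *)

(** * Expected reward of a run under an arbitrary policy *)

Section Expectation.
Variables (R : realType) (U V : finType) (E : U -> V -> bool).
Variables (N : network R E) (pi : policy R E).

Implicit Types (f g : history U V -> R) (h : history U V) (s : seq V).

Lemma expect_cat f h s s' :
  expect N pi f h (s ++ s') = expect N pi (fun h' => expect N pi f h' s') h s.
Proof.
elim: s h => [|t s IH] h //=; rewrite IH; congr (_ + _ * _).
by apply: eq_bigr => d _; rewrite IH.
Qed.

Lemma le_expect f g h s : (forall h', f h' <= g h') ->
  expect N pi f h s <= expect N pi g h s.
Proof.
move=> fg; elim: s h => [|t s IH] h //=.
apply: lerD; apply: ler_wpM2l => //; first by rewrite subr_ge0 prob_le1.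
  exact: prob_ge0.
by apply: ler_sum => d _; rewrite ler_wpM2l ?decision_prob_ge0.
Qed.

Lemma expectD f g h s :
  expect N pi (fun h' => f h' + g h') h s
  = expect N pi f h s + expect N pi g h s.
Proof.
elim: s h => [|t s IH] h //=; rewrite IH.
under eq_bigr do rewrite IH mulrDr.
by rewrite big_split /=; ring.
Qed.

Lemma expect_const (a : R) h s : expect N pi (fun=> a) h s = a.
Proof.
elim: s h => [|t s IH] h //=; rewrite IH.
under eq_bigr do rewrite IH.
by rewrite -mulr_suml decision_prob_sum1; ring.
Qed.

Lemma collected_rcons h e : collected N (rcons h e) =
  collected N h + (if e.2 is Some i then weight N i e.1.1 else 0).
Proof. by rewrite /collected -cats1 big_cat big_seq1. Qed.

Lemma matched_rcons h e i :
  (i \in matched (rcons h e)) = (i \in matched h) || (e.2 == Some i).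
Proof.
rewrite /matched -cats1 pmap_cat mem_cat /=.
by case: e.2 => [j|] //=; rewrite inE (inj_eq (@Some_inj _)) eq_sym.
Qed.

(** A step is a convex combination of its outcomes, so a common bound on them suffices. Decisions of
    probability zero can be skipped, which lets [decision_prob_feasible] be applied to the
    others. *)
Lemma expect_step_le (B : R) f h t s :
  expect N pi f (rcons h (t, false, None)) s <= B ->
  (forall d, decision_prob pi h t d != 0 ->
     expect N pi f (rcons h (t, true, d)) s <= B) ->
  expect N pi f h (t :: s) <= B.
Proof.
move=> BF BT /=; rewrite [leRHS](_ : B = (1 - prob N t) * B + prob N t * B); last by ring.
apply: lerD; apply: ler_wpM2l => //; first by rewrite subr_ge0 prob_le1.
  exact: prob_ge0.
rewrite -[leRHS]mul1r -(decision_prob_sum1 pi h t) mulr_suml.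
apply: ler_sum => d _; have [->|d0] := eqVneq (decision_prob pi h t d) 0.
  by rewrite !mul0r.
by rewrite ler_wpM2l ?decision_prob_ge0 ?BT.
Qed.

Lemma expect_sure f h t s : prob N t = 1 -> expect N pi f h (t :: s) =
  \sum_d decision_prob pi h t d * expect N pi f (rcons h (t, true, d)) s.
Proof. by move=> /= ->; rewrite subrr mul0r add0r mul1r. Qed.

Variable w : V -> R.
Hypothesis weight_le : forall i t, weight N i t <= w t.
Hypothesis w_ge0 : forall t, 0 <= w t.

(** Ignores the capacity of the offline vertices: an arriving [t] is realized with probability
    [prob N t] and then pays at most [w t]. *)
Lemma expect_collected_le h s : expect N pi (collected N) h s <=
  collected N h + \sum_(t <- s) w t * prob N t.
Proof.
elim: s h => [|t s IH] h /=; first by rewrite big_nil addr0.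
rewrite big_cons; set S := \sum_(j <- s) _ in IH *.
have p0 := prob_ge0 N t; have p1 := prob_le1 N t.
have BF : expect N pi (collected N) (rcons h (t, false, None)) s
    <= collected N h + S.
  by apply: le_trans (IH _) _; rewrite collected_rcons /= addr0.
have BT : \sum_d decision_prob pi h t d *
    expect N pi (collected N) (rcons h (t, true, d)) s
    <= collected N h + w t + S.
  rewrite -[leRHS]mul1r -(decision_prob_sum1 pi h t) mulr_suml.
  apply: ler_sum => d _; rewrite ler_wpM2l ?decision_prob_ge0 //.
  apply: le_trans (IH _) _; rewrite collected_rcons lerD2r lerD2l.
  by case: d => [i|] /=.
apply: le_trans (lerD (ler_wpM2l _ BF) (ler_wpM2l p0 BT)) _.
  by rewrite subr_ge0.
by rewrite le_eqVlt; apply/orP; left; apply/eqP; ring.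
Qed.

End Expectation.

(** * Policies that match each online vertex to a prescribed target or not at all *)

Section TargetPolicy.
Variables (R : realType) (U V : finType) (E : U -> V -> bool).
Variables (N : network R E) (target : V -> U).
Hypothesis targetE : forall t, E (target t) t.

Definition target_choice (h : history U V) (t : V) : option U :=
  if target t \in matched h then None else Some (target t).

Definition target_decision (h : history U V) (t : V) (d : option U) : R :=
  (d == target_choice h t)%:R.

Lemma target_decision_sum (f : option U -> R) h t :
  \sum_d target_decision h t d * f d = f (target_choice h t).
Proof.
rewrite (bigD1 (target_choice h t)) //= /target_decision eqxx mul1r big1 ?addr0//.
by move=> d /negPf ->; rewrite mul0r.
Qed.

Lemma target_decision_ge0 h t d : 0 <= target_decision h t d.
Proof. exact: ler0n. Qed.

Lemma target_decision_sum1 h t : \sum_d target_decision h t d = 1.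
Proof.
by rewrite -[RHS](target_decision_sum (fun=> 1) h t); apply: eq_bigr => d _; rewrite mulr1.
Qed.

Lemma target_decision_feasible h t i :
  target_decision h t (Some i) != 0 -> E i t /\ i \notin matched h.
Proof.
rewrite /target_decision pnatr_eq0 eqb0 negbK /target_choice.
by case: ifPn => // th /eqP[->].
Qed.

Definition target_policy : policy R E :=
  Policy target_decision_ge0 target_decision_sum1 target_decision_feasible.

(** Expected weight that a still unmatched [i] collects: it goes to the first realized vertex of [s]
    whose target is [i]. *)
Fixpoint gain (s : seq V) (i : U) : R :=
  if s is t :: s' then
    if target t == i then prob N t * weight N i t + (1 - prob N t) * gain s' i
    else gain s' i
  else 0.

(** With fixed targets the offline vertices do not compete, so the reward splits over them: the
    arrival of [t] affects only the summand of [target t]. *)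
Lemma expect_target h s : expect N target_policy (collected N) h s =
  collected N h + \sum_(i | i \notin matched h) gain s i.
Proof.
elim: s h => [|t s IH] h; first by rewrite /= big1 ?addr0.
rewrite /= target_decision_sum !IH !collected_rcons /= /target_choice.
under eq_bigl do rewrite matched_rcons orbF.
case: ifPn => th /=.
  (* The target is already taken, so every unmatched [i] differs from it and keeps its gain. *)
  under [X in _ + _ * (_ + X)]eq_bigl do rewrite matched_rcons orbF.
  rewrite [X in _ = _ + X](eq_bigr (gain s)); first by ring.
  by move=> i ih; case: eqP => // ti; rewrite ti (negPf ih) in th.
rewrite (bigD1 (target t)) //= [in RHS](bigD1 (target t)) //= eqxx.
set S := \sum_(i | _ && _) gain s i.
rewrite [X in _ = _ + (_ + X)](_ : _ = S); last first.
  by apply: eq_bigr => i /andP[_ ne]; rewrite eq_sym (negPf ne).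
have -> : \sum_(i | i \notin matched (rcons h (t, true, Some (target t))))
    gain s i = S.
  apply: eq_bigl => i.
  by rewrite matched_rcons /= (inj_eq (@Some_inj _)) negb_or [target t == i]eq_sym.
by ring.
Qed.

Lemma reward_target s : reward N target_policy s = \sum_i gain s i.
Proof. by rewrite /reward expect_target /collected big_nil add0r. Qed.

End TargetPolicy.

(** The tail infima increase to the limit inferior, so they eventually exceed [a], and each is a
    lower bound of its first term. *)
Lemma limn_einf_near_ge (R : realType) (u : (\bar R)^nat) (a : R) :
  (a%:E < limn_einf u)%E -> \forall n \near \oo, (a%:E <= u n)%E.
Proof.
rewrite limn_einf_lim => au.
near=> n; apply: (@le_trans _ _ (einfs u n)).
  near: n; exact: lte_lim (@nondecreasing_einfs _ _) (@is_cvg_einfs _ _) au.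
by apply: ereal_inf_lbound; exists n => //=.
Unshelve. all: by end_near. Qed.

(** * The hard instance and its two arrival orders *)

Section Triangle.
Variable R : realType.

(* [(true, j)] is deterministic and [(false, j)] is free. *)
Definition tri_edge (i : 'I_3) (t : bool * 'I_3) : bool :=
  if t.1 then i != t.2 else i == t.2.

(** The weight of a free vertex is the inverse of its probability [harmonic k], so every online
    vertex has value 1. *)
Definition tri_vertex_weight (k : nat) (t : bool * 'I_3) : R :=
  if t.1 then 1 else k.+1%:R.

Definition tri_weight (k : nat) (i : 'I_3) (t : bool * 'I_3) : R :=
  if tri_edge i t then tri_vertex_weight k t else 0.

Definition tri_prob (k : nat) (t : bool * 'I_3) : R :=
  if t.1 then 1 else harmonic k.

Lemma tri_vertex_weight_ge0 k t : 0 <= tri_vertex_weight k t.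
Proof. by rewrite /tri_vertex_weight; case: ifP. Qed.

Lemma tri_weight_ge0 k i t : 0 <= tri_weight k i t.
Proof. by rewrite /tri_weight; case: ifP => // _; exact: tri_vertex_weight_ge0. Qed.

Lemma tri_weight_off k i t : ~~ tri_edge i t -> tri_weight k i t = 0.
Proof. by rewrite /tri_weight => /negPf ->. Qed.

Lemma harmonic_le1 k : harmonic k <= 1 :> R.
Proof. by rewrite /= invf_le1 ?ltr0n // ler1n. Qed.

Lemma tri_prob_ge0 k t : 0 <= tri_prob k t.
Proof. by rewrite /tri_prob; case: ifP => // _; exact: harmonic_ge0. Qed.

Lemma tri_prob_le1 k t : tri_prob k t <= 1.
Proof. by rewrite /tri_prob; case: ifP => // _; exact: harmonic_le1. Qed.

Definition tri_net (k : nat) : network R tri_edge :=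
  Network (@tri_weight_ge0 k) (@tri_weight_off k) (@tri_prob_ge0 k)
    (@tri_prob_le1 k).

Lemma tri_weight_prob k t : tri_vertex_weight k t * tri_prob k t = 1.
Proof.
rewrite /tri_vertex_weight /tri_prob; case: ifP => _; first by rewrite mulr1.
by rewrite /= divff // pnatr_eq0.
Qed.

Lemma tri_weight_le k i t : tri_weight k i t <= tri_vertex_weight k t.
Proof.
by rewrite /tri_weight; case: ifP => // _; exact: tri_vertex_weight_ge0.
Qed.

Definition tri_prefix : seq (bool * 'I_3) := [:: (false, 1); (false, -1)].

Definition tri_suffix (e : 'I_3) : seq (bool * 'I_3) :=
  [:: (true, 0); (true, e); (false, 0); (true, - e)].

Definition tri_arrivals (e : 'I_3) := tri_prefix ++ tri_suffix e.

Lemma ord3_cases (e i : 'I_3) : e != 0 -> [\/ i = 0, i = e | i = - e].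
Proof.
move=> e0; suff: [|| i == 0, i == e | i == - e].
  by case/or3P => /eqP; [constructor 1 | constructor 2 | constructor 3].
by case: e e0 => [[|[|[|]]]] // ? _; case: i => [[|[|[|]]]].
Qed.

Lemma ord3_nonzero (e : 'I_3) : e != 0 -> e = 1 \/ e = -1.
Proof. by move=> e0; case: (@ord3_cases 1 e isT) e0 => -> //; [left | right]. Qed.

Lemma tri_arrivalsP e : e != 0 -> arrival_order (tri_arrivals e).
Proof.
move=> /ord3_nonzero e1; apply: uniq_perm; rewrite ?enum_uniq //.
  by case: e1 => ->.
move=> [b i]; rewrite mem_enum inE.
by case: e1 => ->; case: b; case: i => [[|[|[|]]]].
Qed.

(** Each vertex still to come is worth at most 1 in expectation, so bounding a reward becomes
    counting arrivals. *)
Lemma tri_collected_le k (pi : policy R tri_edge) h s :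
  expect (tri_net k) pi (collected (tri_net k)) h s
  <= collected (tri_net k) h + (size s)%:R.
Proof.
have := @expect_collected_le _ _ _ _ (tri_net k) pi _ (@tri_weight_le k)
  (@tri_vertex_weight_ge0 k) h s.
move=> /le_trans; apply.
under eq_bigr do rewrite tri_weight_prob.
by rewrite big_const_seq count_predT -Monoid.iteropE /= lexx.
Qed.

(** * Upper bound on the total reward of one policy over the two orders *)

Section Policy.
Variables (k : nat) (pi : policy R tri_edge).
Local Notation N := (tri_net k).
Local Notation V := (expect N pi (collected N)).

Lemma tri_missed_le h t s : V (rcons h (t, false, None)) s
  <= collected N h + (size s)%:R.
Proof.
by apply: le_trans (tri_collected_le _ _ _ _) _; rewrite collected_rcons addr0.
Qed.

Lemma tri_unmatched_le h t s : V (rcons h (t, true, None)) s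
  <= collected N h + (size s)%:R.
Proof.
by apply: le_trans (tri_collected_le _ _ _ _) _; rewrite collected_rcons addr0.
Qed.

Lemma tri_collected_rcons h j i : tri_edge i (true, j) ->
  collected N (rcons h (true, j, true, Some i)) = collected N h + 1.
Proof. by move=> ij; rewrite collected_rcons /= /tri_weight ij. Qed.

(** The only neighbour of free [j] is offline [j], so this arrival is lost. *)
Lemma tri_blocked_free_le h j s : j \in matched h ->
  V h ((false, j) :: s) <= collected N h + (size s)%:R.
Proof.
move=> jh; apply: expect_step_le => [|[i|] di]; first exact: tri_missed_le.
  case: (decision_prob_feasible di) => /eqP -> /=.
  by rewrite jh.
exact: tri_unmatched_le.
Qed.

(** The neighbours of det [e] are 0 and [- e]. With [- e] taken, det [e] either stays unmatched or
    takes 0 and blocks free 0; one of the three arrivals is lost in both cases. *)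
Lemma tri_wrong_choice_le e h : e != 0 -> - e \in matched h ->
  V h [:: (true, e); (false, 0); (true, - e)] <= collected N h + 2.
Proof.
move=> e0 eh; apply: expect_step_le => [|[i|] di].
- exact: le_trans (tri_missed_le _ _ _) _.
- case: (decision_prob_feasible di) => ie ih.
  have -> : i = 0.
    case: (ord3_cases i e0) => // ii; last by rewrite ii eh in ih.
    by rewrite ii /tri_edge /= eqxx in ie.
  apply: le_trans (tri_blocked_free_le _ _) _.
    by rewrite matched_rcons /= eqxx orbT.
  by rewrite tri_collected_rcons /tri_edge /= 1?eq_sym // -addrA.
- exact: le_trans (tri_unmatched_le _ _ _) _.
Qed.

Lemma tri_suffix_le e h : e != 0 -> V h (tri_suffix e)
  <= collected N h + 3 + decision_prob pi h (true, 0) (Some e).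
Proof.
move=> e0; rewrite expect_sure //.
(* The bound is written as an average over the decisions for det 0, to be compared term by term:
   [Some e] allows 1 + 3, [None] allows 3, and [Some (- e)] allows 1 + 2. *)
rewrite [leRHS](_ : _ = \sum_d decision_prob pi h (true, 0) d *
    (collected N h + 3 + (d == Some e)%:R)); last first.
  under [RHS]eq_bigr do rewrite mulrDr.
  rewrite big_split /= -mulr_suml decision_prob_sum1 mul1r; congr (_ + _).
  rewrite (bigD1 (Some e)) //= eqxx mulr1 big1 ?addr0 // => d /negPf ->.
  by rewrite mulr0.
apply: ler_sum => d _.
have [->|d0] := eqVneq (decision_prob pi h (true, 0) d) 0.
  by rewrite !mul0r.
apply: ler_wpM2l; first exact: decision_prob_ge0.
case: d d0 => [i|] di; last by rewrite addr0; exact: tri_unmatched_le.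
have [i0 ih] := decision_prob_feasible di.
case: (ord3_cases i e0) => ii; first by rewrite ii in i0.
  rewrite ii eqxx; apply: le_trans (tri_collected_le _ _ _ _) _.
  by rewrite tri_collected_rcons // addrAC.
apply: le_trans (tri_wrong_choice_le e0 _) _.
  by rewrite matched_rcons /= ii eqxx orbT.
rewrite tri_collected_rcons // -addrA -addrA lerD2l.
by rewrite (_ : 1 + 2 = 3) ?lerDl ?ler0n //; ring.
Qed.

(** Both orders reach det 0 with the same distribution of histories, and matching it to 1 and to -1
    are exclusive decisions. So the suffixes give at most 3 + 3 + 1 = 7 together, and the common
    prefix at most 2 for each order. *)
Lemma tri_reward_sum_le :
  reward N pi (tri_arrivals 1) + reward N pi (tri_arrivals (-1)) <= 11.
Proof.
rewrite /reward !expect_cat -expectD.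
apply: (@le_trans _ _ (expect N pi
    (fun h => collected N h + collected N h + 7) [::] tri_prefix)).
  apply: le_expect => h.
  apply: le_trans (lerD (@tri_suffix_le 1 h isT) (@tri_suffix_le (-1) h isT)) _.
  suff: decision_prob pi h (true, 0) (Some 1)
      + decision_prob pi h (true, 0) (Some (-1)) <= 1 by lra.
  rewrite -(decision_prob_sum1 pi h (true, 0)).
  rewrite (bigD1 (Some 1)) //= (bigD1 (Some (-1))) //= addrA lerDl.
  by apply: sumr_ge0 => d _; exact: decision_prob_ge0.
rewrite 2!expectD expect_const.
have := tri_collected_le k pi [::] tri_prefix.
by rewrite {2}/collected big_nil add0r /=; lra.
Qed.

Lemma tri_reward_le s : reward N pi s <= (size s)%:R.
Proof.
by apply: le_trans (tri_collected_le _ _ _ _) _; rewrite /collected big_nil add0r.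
Qed.

End Policy.

(** * The online optimum and the LP value both tend to 6 *)

Definition tri_target (e : 'I_3) (t : bool * 'I_3) : 'I_3 :=
  if t.1 then t.2 + e else t.2.

Lemma tri_targetE e : e != 0 -> forall t, tri_edge (tri_target e t) t.
Proof.
by move=> e0 [[] j]; rewrite /tri_edge /tri_target /= ?eqxx // -subr_eq0 addrC addKr.
Qed.

(** Each offline vertex meets its free vertex first and then one deterministic vertex, hence 1 + (1
    - [harmonic k]). *)
Lemma tri_gain k e i : e != 0 ->
  gain (tri_net k) (tri_target e) (tri_arrivals e) i = 2 - harmonic k.
Proof.
have wp : harmonic k * k.+1%:R = 1 :> R by rewrite /= mulVf ?pnatr_eq0.
move=> /ord3_nonzero e1; rewrite /= /tri_weight /tri_vertex_weight /tri_prob.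
by case: e1 => ->; case: i => [[|[|[|]]]] // ? /=; rewrite wp; ring.
Qed.

Lemma tri_reward_target k e (e0 : e != 0) :
  reward (tri_net k) (target_policy R (tri_targetE e0)) (tri_arrivals e)
  = 6 - 3 * harmonic k.
Proof.
rewrite reward_target; under eq_bigr do rewrite tri_gain //.
by rewrite sumr_const card_ord -mulr_natl; ring.
Qed.

Lemma tri_OPT_bounds k e : e != 0 ->
  6 - 3 * harmonic k <= OPT_online (tri_net k) (tri_arrivals e) <= 6.
Proof.
move=> e0; apply/andP; split.
  apply: ub_le_sup; first by exists 6 => _ [pi _ <-]; exact: tri_reward_le.
  by exists (target_policy R (tri_targetE e0)) => //; exact: tri_reward_target.
apply: ge_sup; last by move=> _ [pi _ <-]; exact: tri_reward_le.
by exists (reward (tri_net k) (target_policy R (tri_targetE e0)) (tri_arrivals e));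
  exists (target_policy R (tri_targetE e0)).
Qed.

(** Each deterministic vertex is split evenly between its two neighbours, scaled so that every
    offline vertex has load exactly 1. *)
Definition tri_fraction (k : nat) (i : 'I_3) (t : bool * 'I_3) : R :=
  if t.1 then (1 - harmonic k) / 2 else harmonic k.

Lemma tri_pair_sum (f : bool * 'I_3 -> R) :
  \sum_t f t = \sum_j f (true, j) + \sum_j f (false, j).
Proof.
transitivity (\sum_(b : bool) \sum_j f (b, j)); last by rewrite big_bool.
by rewrite pair_big; apply: eq_bigr => -[].
Qed.

Lemma tri_fraction_sum k t :
  \sum_(i | tri_edge i t) tri_fraction k i t
  = if t.1 then 1 - harmonic k else harmonic k.
Proof.
case: t => [[] j]; rewrite /tri_edge /tri_fraction /= sumr_const.
  by rewrite -/(predC1 j) cardC1 card_ord /= -mulr_natl; field.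
by rewrite -/(pred1 j) card1.
Qed.

Lemma tri_fraction_feasible k : ex_ante_feasible (tri_net k) (tri_fraction k).
Proof.
have p0 := @harmonic_ge0 R k; have p1 := harmonic_le1 k.
split => [i t _ | [b j] | i].
- by rewrite /tri_fraction; case: ifP => _; lra.
- by rewrite tri_fraction_sum /= /tri_prob; case: b => //=; rewrite gerBl.
rewrite big_mkcond tri_pair_sum -!big_mkcond /=.
rewrite /tri_fraction /tri_edge /= !sumr_const.
rewrite (@eq_card _ _ (predC1 i)) => [|j]; last by rewrite !inE eq_sym.
rewrite [X in _ + _ *+ X](@eq_card _ _ (pred1 i)) => [|j]; last first.
  by rewrite !inE eq_sym.
rewrite cardC1 card1 card_ord /=.
by rewrite mulr1n mulr2n -splitr subrK.
Qed.

(** Summed by online vertex, the constraint at [t] caps its contribution by its value 1, and there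
    are six of them. *)
Lemma tri_LP_le k x : ex_ante_feasible (tri_net k) x ->
  ex_ante_value (tri_net k) x <= 6.
Proof.
move=> [x0 xp _]; rewrite /ex_ante_value.
under eq_bigr do rewrite big_mkcond.
rewrite exchange_big /=.
apply: (@le_trans _ _ (\sum_(t : bool * 'I_3) 1)); last first.
  by rewrite sumr_const card_prod card_bool card_ord.
apply: ler_sum => t _; rewrite -big_mkcond -(tri_weight_prob k t).
apply: le_trans (ler_wpM2l (tri_vertex_weight_ge0 k t) (xp t)).
rewrite mulr_sumr; apply: ler_sum => i it.
by rewrite /tri_weight it.
Qed.

Lemma tri_fraction_value k :
  ex_ante_value (tri_net k) (tri_fraction k) = 6 - 3 * harmonic k.
Proof.
rewrite /ex_ante_value.
under eq_bigr do rewrite big_mkcond.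
rewrite exchange_big tri_pair_sum.
rewrite (eq_bigr (fun=> 1 - harmonic k)) => [|j _]; last first.
  rewrite -big_mkcond -[RHS](tri_fraction_sum k (true, j)).
  by apply: eq_bigr => i ij; rewrite /= /tri_weight ij mul1r.
rewrite [X in _ + X](eq_bigr (fun=> 1)) => [|j _]; last first.
  rewrite -big_mkcond -(tri_weight_prob k (false, j)).
  rewrite -[tri_prob _ _](tri_fraction_sum k (false, j)) mulr_sumr.
  by apply: eq_bigr => i ij; rewrite /= /tri_weight ij.
by rewrite !sumr_const card_ord; ring.
Qed.

Lemma tri_LP_bounds k : 6 - 3 * harmonic k <= LP_ex_ante (tri_net k) <= 6.
Proof.
apply/andP; split.
  apply: ub_le_sup; first by exists 6 => _ [x xf <-]; exact: tri_LP_le.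
  exists (tri_fraction k); first exact: tri_fraction_feasible.
  exact: tri_fraction_value.
apply: ge_sup; last by move=> _ [x xf <-]; exact: tri_LP_le.
by exists (ex_ante_value (tri_net k) (tri_fraction k)), (tri_fraction k);
  first exact: tri_fraction_feasible.
Qed.

Lemma cvg_tri_bounds (u : R^nat) :
  (forall k, 6 - 3 * harmonic k <= u k <= 6) -> u k @[k --> \oo] --> (6 : R).
Proof.
move=> ub; apply: (@squeeze_cvgr _ _ _ _ (fun k => 6 - 3 * harmonic k) (fun=> 6)).
- by near=> k; exact: ub.
- rewrite -[X in _ --> X](subr0 6) -[X in _ --> _ - X](mulr0 3).
  by apply: cvgB; [exact: cvg_cst | apply: cvgMr; exact: cvg_harmonic].
- exact: cvg_cst.
Unshelve. all: by end_near. Qed.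

(** * Membership in the class *)

Definition tri_determ : {set bool * 'I_3} := [set t | t.1]%SET.

Definition tri_instance (e : 'I_3) (e0 : e != 0) : asym_instance R :=
  @AsymInstance R _ _ tri_edge (tri_arrivals e) (tri_arrivalsP e0)
    tri_determ (fun=> 1) (fun=> ler01) tri_net.

Lemma tri_free_val e (e0 : e != 0) (i : 'I_3) :
  @free_val R (tri_instance e0) i = 1.
Proof.
rewrite /free_val /= (big_pred1 (false, i)) // => -[[] j].
  by rewrite inE.
by rewrite inE /tri_edge /=; apply/eqP/eqP => [-> | []].
Qed.

Lemma tri_matching_weight k (M : {set 'I_3 * (bool * 'I_3)}) :
  @matching_to _ _ tri_edge tri_determ M ->
  matching_weight (tri_net k) M = #|M|%:R.
Proof.
move=> [ME _]; rewrite /matching_weight -sum1_card natr_sum.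
apply: eq_bigr => -[i [b j]] /ME[/= ij]; rewrite inE /= => b1.
by rewrite /tri_weight ij /tri_vertex_weight /= b1.
Qed.

Definition tri_perfect : {set 'I_3 * (bool * 'I_3)} :=
  [set (i, (true, i + 1)) | i : 'I_3]%SET.

Lemma tri_perfect_matching : @matching_to _ _ tri_edge tri_determ tri_perfect.
Proof.
split => [_ /imsetP[i _ ->] | _ _ /imsetP[i _ ->] /imsetP[j _ ->] /=].
  by rewrite inE /=; split => //; case: i => [[|[|[|]]]].
by case => [-> // | /(congr1 snd)/addIr ->].
Qed.

(** Comparison with [tri_perfect] forces at least three edges in a maximum-weight matching. It
    therefore covers every offline vertex, each by one edge of weight 1. *)
Lemma tri_balanced e (e0 : e != 0) : balanced (tri_instance e0).
Proof.
move=> k M [MM Mmax] i; rewrite tri_free_val.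
have := Mmax _ tri_perfect_matching.
rewrite !tri_matching_weight //; last exact: tri_perfect_matching.
rewrite ler_nat card_imset => [|? ? [] //]; rewrite card_ord => M3.
have [ME Muniq] := MM.
have fst_inj : {in M &, injective fst}.
  by move=> a b aM bM ab; apply: Muniq => //; left.
have MT : [set a.1 | a in M]%SET = [set: 'I_3]%SET.
  by apply/eqP; rewrite eqEcard finset.subsetT cardsT card_ord card_in_imset.
have : i \in [set a.1 | a in M]%SET by rewrite MT inE.
case/imsetP => -[i' [b j]] aM /= ii; rewrite -{i'}ii in aM.
have [/= ij] := ME _ aM; rewrite inE /= => b1.
rewrite /weight_at (big_pred1 (b, j)) /=.
  by rewrite /tri_weight ij /tri_vertex_weight b1.
move=> t; apply/idP/eqP => [tM | -> //].
by have [] := Muniq _ _ tM aM (or_introl erefl).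
Qed.

Lemma tri_class_C e (e0 : e != 0) : class_C (tri_instance e0).
Proof.
split.
- split => [k [b j] | [b j]]; rewrite inE /=; first by move=> b1; rewrite /tri_prob b1.
  move=> /negPf b0; rewrite /tri_prob /= b0.
  by split=> [k|]; [exact: harmonic_gt0 | exact: cvg_harmonic].
- split => [k | t]; last by exists (tri_target e t); exact: tri_targetE.
  exists (tri_vertex_weight k); split => [i t it | t]; last exact: tri_weight_prob.
  by rewrite /= /tri_weight (_ : tri_edge i t).
- exists 6; split; apply: cvg_tri_bounds => k; last exact: tri_LP_bounds.
  exact: tri_OPT_bounds.
- exact: tri_balanced.
- move=> [b j]; rewrite inE /= => /negPf b0.
  transitivity #|pred1 j|; last exact: card1.
  by apply: eq_card => i; rewrite !inE /= /tri_edge /= b0.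
Qed.

Lemma tri_OPT_gt0 e (e0 : e != 0) k : 0 < OPT_seq (tri_instance e0) k.
Proof.
have /andP[+ _] := tri_OPT_bounds k e0.
by apply: lt_le_trans; have := harmonic_le1 k; lra.
Qed.

End Triangle.

(** * One of the two orders defeats the algorithm *)

Theorem mainTheorem2 (R : realType) (A : order_unaware R) (c : R)
    (hc : 11%:R / 12%:R < c) :
  exists I : asym_instance R,
    [/\ class_C I,
        (forall k, 0 < OPT_seq I k) &
        (limn_einf (fun k => (ALG_seq I A k / OPT_seq I k)%:E) < c%:E)%E].
Proof.
pose ratio e (e0 : e != 0 :> 'I_3) k :=
  (ALG_seq (tri_instance R e0) A k / OPT_seq (tri_instance R e0) k)%:E.
suff [[e e0] ec] : exists e : {e : 'I_3 | e != 0},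
    (limn_einf (ratio _ (valP e)) < c%:E)%E.
  exists (tri_instance R e0); split => //; first exact: tri_class_C.
  exact: tri_OPT_gt0.
apply: contrapT => /forallNP large.
(* The midpoint lies strictly below [c], so both ratios are eventually at least [a], and strictly
   above 11/12, which contradicts the bound 11. *)
pose a : R := (c + 11 / 12) / 2.
have a_gt : 11 / 12 < a by rewrite /a; lra.
have ALG_ge e (e0 : e != 0 :> 'I_3) : \forall k \near \oo,
    a * (6 - 3 * harmonic k) <= reward (tri_net R k)
      (A _ _ _ (tri_net R k)) (tri_arrivals e).
  have /negP := large (exist _ e e0); rewrite -leNgt => cl.
  have : (a%:E < limn_einf (ratio e e0))%E.
    apply: lt_le_trans cl; rewrite lte_fin /a; lra.
  move=> /limn_einf_near_ge; apply: filterS => k.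
  rewrite lee_fin ler_pdivlMr; last exact: tri_OPT_gt0.
  apply: le_trans; rewrite ler_pM2l; last by lra.
  by have /andP[] := tri_OPT_bounds R k e0.
(* This threshold is equivalent to 2 * [a] * (6 - 3 * [harmonic k]) > 11; it is positive because [a]
   > 11/12. *)
have small : \forall k \near \oo, harmonic k < 2 - 11 / (6 * a) :> R.
  have := @cvg_harmonic R; move/cvgr_lt; apply.
  by rewrite subr_gt0 ltr_pdivrMr; lra.
have [k []] := filter_ex (filterI (filterI (ALG_ge 1 isT) (ALG_ge (-1) isT)) small).
move=> [A1 A2]; rewrite ltrBrDr -ltrBrDl ltr_pdivrMr => [kh|]; last by lra.
have := tri_reward_sum_le k (A _ _ _ (tri_net R k)).
by nra.
Qed.
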